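(* Let $X$ be a Banach space, $F$ a Banach lattice and $T: X \to F$ a bounded linear operator. The following are equivalent: (1) $T$ is an almost Grothendieck operator; (2) $S \circ T: X \to c_0$ is weakly compact for every disjoint operator $S: F \to c_0$; (3) $T(A)$ is an almost Grothendieck set in $F$ for every bounded set $A \subset X$; (4) $T(B_X)$ is an almost Grothendieck set in $F$.
   Context: $B_X$ is the closed unit ball of $X$. Every bounded linear operator $S: F \to c_0$ has the form $S(y) = (y_n'(y))_n$ for a unique weak* null sequence $(y_n') \subset F'$; $S$ is a disjoint operator if $(y_n')$ is disjoint in the dual Banach lattice $F'$. A subset $A \subset F$ is almost Grothendieck if $S(A)$ is relatively weakly compact in $c_0$ for every disjoint operator $S: F \to c_0$. A bounded operator $T: X \to F$ is almost Grothendieck if $T'y_n' \to 0$ weakly in $X'$ for every disjoint weak* null sequence $(y_n') \subset F'$. *)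

(* Defs.v *)
From HB Require Import structures.
From mathcomp Require Import all_boot all_order all_algebra.
From mathcomp Require Import all_classical all_reals all_analysis.
Set Implicit Arguments. Unset Strict Implicit. Unset Printing Implicit Defensive.
Import Order.TTheory GRing.Theory Num.Theory.
Import numFieldNormedType.Exports.
Local Open Scope classical_set_scope.
Local Open Scope ring_scope.

Definition lat_abs (R : realType) (F : normedModType R)
  (join : F -> F -> F) (x : F) : F := join x (- x).

Record isBanachLattice (R : realType) (F : completeNormedModType R)
    (le : F -> F -> Prop) (join : F -> F -> F) : Prop := {
  bl_refl : forall x, le x x;
  bl_trans : forall x y z, le x y -> le y z -> le x z;
  bl_antisym : forall x y, le x y -> le y x -> x = y;
  bl_add : forall x y z, le x y -> le (x + z) (y + z);
  bl_scale : forall (a : R) x y, 0 <= a -> le x y -> le (a *: x) (a *: y);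
  bl_join_l : forall x y, le x (join x y);
  bl_join_r : forall x y, le y (join x y);
  bl_join_least : forall x y z, le x z -> le y z -> le (join x y) z;
  bl_norm : forall x y, le (lat_abs join x) (lat_abs join y) -> `|x| <= `|y| }.

Definition is_dual (R : realType) (V : normedModType R) (f : V -> R) : Prop :=
  (forall x y, f (x + y) = f x + f y) /\
  (forall (a : R) x, f (a *: x) = a * f x) /\
  (exists C : R, forall x, `|f x| <= C * `|x|).

(* The bidual X'': bounded linear functionals on X' (with its dual norm
   ||f|| = sup_{||x||<=1} |f x|; boundedness is stated as |phi f| <= C * M
   for every upper bound M of |f| on the unit ball). *)
Definition is_bidual (R : realType) (V : normedModType R)
    (phi : (V -> R) -> R) : Prop :=
  (forall f g, is_dual f -> is_dual g ->
     phi (fun x => f x + g x) = phi f + phi g) /\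
  (forall (a : R) f, is_dual f -> phi (fun x => a * f x) = a * phi f) /\
  (exists C : R, forall f (M : R), is_dual f ->
     (forall x : V, `|x| <= 1 -> `|f x| <= M) -> `|phi f| <= C * M).

Definition weak_star_null (R : realType) (V : normedModType R)
    (y : nat -> V -> R) : Prop :=
  (forall n, is_dual (y n)) /\ (forall v, (fun n => y n v) @ \oo --> (0 : R)).

Definition weakly_null_dual (R : realType) (V : normedModType R)
    (y : nat -> V -> R) : Prop :=
  (forall n, is_dual (y n)) /\
  (forall phi, is_bidual phi -> (fun n => phi (y n)) @ \oo --> (0 : R)).

Section DualLattice.
Variables (R : realType) (F : completeNormedModType R) (le : F -> F -> Prop).

Definition dle (f g : F -> R) : Prop := forall x, le 0 x -> f x <= g x.

Definition dual_is_sup (f g s : F -> R) : Prop :=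
  is_dual s /\ dle f s /\ dle g s /\
  (forall t, is_dual t -> dle f t -> dle g t -> dle s t).

Definition dual_is_inf (f g s : F -> R) : Prop :=
  is_dual s /\ dle s f /\ dle s g /\
  (forall t, is_dual t -> dle t f -> dle t g -> dle t s).

Definition dual_disjoint (f g : F -> R) : Prop :=
  forall af ag, dual_is_sup f (fun x => - f x) af ->
                dual_is_sup g (fun x => - g x) ag ->
                dual_is_inf af ag (fun _ => 0).

Definition disjoint_seq (y : nat -> F -> R) : Prop :=
  forall n m, n <> m -> dual_disjoint (y n) (y m).
End DualLattice.

Definition c0 (R : realType) := {u : nat -> R | `[< u @ \oo --> (0 : R) >]}.

Definition c0_dual_pred (R : realType) (f : c0 R -> R) : Prop :=
  (forall u v w : c0 R, (forall n, val w n = val u n + val v n) ->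
     f w = f u + f v) /\
  (forall (a : R) (u w : c0 R), (forall n, val w n = a * val u n) ->
     f w = a * f u) /\
  (exists C : R, forall (u : c0 R) (M : R),
     (forall n, `|val u n| <= M) -> `|f u| <= C * M).

Definition c0_dual (R : realType) := {f : c0 R -> R | `[< c0_dual_pred f >]}.

Definition c0_weak (R : realType) :=
  initial_topology (fun u : c0 R => (fun f : c0_dual R => val f u)
                                    : {ptws c0_dual R -> R}).

Definition rel_weakly_compact_c0 (R : realType) (A : set (nat -> R)) : Prop :=
  (forall u, A u -> u @ \oo --> (0 : R)) /\
  compact (closure ([set u : c0_weak R | A (val u)])).

Definition c0_operator (R : realType) (V : normedModType R)
    (S : V -> nat -> R) : Prop :=
  (forall y, S y @ \oo --> (0 : R)) /\
  (forall n, is_dual (fun y => S y n)) /\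
  (exists C : R, forall y n, `|S y n| <= C * `|y|).

Definition disjoint_c0_operator (R : realType) (F : completeNormedModType R)
    (le : F -> F -> Prop) (S : F -> nat -> R) : Prop :=
  c0_operator S /\ disjoint_seq le (fun n y => S y n).

Definition unit_ball (R : realType) (V : normedModType R) : set V :=
  [set x | `|x| <= 1].

Definition bounded_set_nm (R : realType) (V : normedModType R) (A : set V) :=
  exists M : R, forall x, A x -> `|x| <= M.

Definition weakly_compact_c0_operator (R : realType) (V : normedModType R)
    (S : V -> nat -> R) : Prop :=
  rel_weakly_compact_c0 (S @` @unit_ball R V).

Definition almost_Grothendieck_set (R : realType) (F : completeNormedModType R)
    (le : F -> F -> Prop) (A : set F) : Prop :=
  forall S : F -> nat -> R, disjoint_c0_operator le S ->
    rel_weakly_compact_c0 (S @` A).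

Definition almost_Grothendieck_op (R : realType) (X F : completeNormedModType R)
    (le : F -> F -> Prop) (T : X -> F) : Prop :=
  forall y : nat -> F -> R, weak_star_null y -> disjoint_seq le y ->
    weakly_null_dual (fun n x => y n (T x)).

(* Main.v *)
Require Import Defs.
From HB Require Import structures.
From mathcomp Require Import all_boot all_order all_algebra.
From mathcomp Require Import all_classical all_reals all_analysis.
From mathcomp Require Import lra ring.
Import Order.TTheory GRing.Theory Num.Theory.
Import numFieldNormedType.Exports.
Local Open Scope classical_set_scope.
Local Open Scope ring_scope.

(* Write u_n = y_n o T, so that S o T = (u_n)_n.  If (u_n) is weakly null in X',
   then the image under phi |-> (phi u_n)_n of a ball of X'' lies in c0 and is
   weakly compact, because functionals on c0 have uniformly small tails and
   hence the weak topology is coordinatewise convergence on bounded sets.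
   Conversely, for phi of norm at most 1 in X'', Helly's theorem provides points
   x_k of the unit ball with u_i x_k --> phi u_i for each i; weak compactness of
   S (T (B_X)) gives (S (T x_k))_k a cluster point in c0, and its coordinates
   must be phi u_i, so phi u_i --> 0.  The Banach-Steinhaus theorem makes a
   weak* null sequence in F' an operator into c0. *)

(** * Bounded functionals on [c0]: small tails and convergence on bounded sets *)

Section C0.
Context {R : realType}.
Implicit Types (u v l : c0 R) (f : c0 R -> R).

Lemma c0_cvg0 u : val u @ \oo --> (0 : R).
Proof. by case: u => s /= /asboolP. Qed.

Definition c0_mk (s : nat -> R) (hs : s @ \oo --> (0 : R)) : c0 R :=
  exist _ s (asboolT hs).

Lemma c0_comb_subproof (a b : R) u v :
  (fun n => a * val u n + b * val v n) @ \oo --> (0 : R).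
Proof.
rewrite -[X in _ --> X](_ : a * 0 + b * 0 = 0); last by rewrite !mulr0 addr0.
apply: cvgD; apply: cvgM; [exact: cvg_cst|exact: c0_cvg0|exact: cvg_cst|exact: c0_cvg0].
Qed.

(** Linearity in [c0_dual_pred] is stated through coordinates, so this one operation stands in for
    the vector space structure of [c0]. *)
Definition c0_comb a b u v : c0 R := c0_mk _ (c0_comb_subproof a b u v).

Lemma c0_cut_subproof (N : nat) u :
  (fun n => if (n < N)%N then val u n else 0) @ \oo --> (0 : R).
Proof.
apply: cvg_near_cst; exists N => // n /= Nn.
by rewrite ltnNge Nn.
Qed.

Definition c0_cut N u : c0 R := c0_mk _ (c0_cut_subproof N u).

Lemma c0_combE a b u v n :
  val (c0_comb a b u v) n = a * val u n + b * val v n.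
Proof. by []. Qed.

Lemma c0_cutE N u n : val (c0_cut N u) n = if (n < N)%N then val u n else 0.
Proof. by []. Qed.

Lemma c0_dual_comb f a b u v : c0_dual_pred f ->
  f (c0_comb a b u v) = a * f u + b * f v.
Proof.
move=> [fD [fZ _]].
have Z c w : f (c0_comb c 0 w w) = c * f w.
  by apply: fZ => n /=; rewrite mul0r addr0.
rewrite -(Z a u) -(Z b v); apply: fD => n /=.
by rewrite !mul0r !addr0.
Qed.

(** A strictly positive constant lets later estimates divide by it. *)
Lemma c0_dual_bound f : c0_dual_pred f -> exists2 C : R, 0 < C &
  forall u (M : R), (forall n, `|val u n| <= M) -> `|f u| <= C * M.
Proof.
move=> [_ [_ [C fC]]]; exists (`|C| + 1); first by rewrite ltr_pwDr.
move=> u M uM; apply: (le_trans (fC u M uM)); apply: ler_wpM2r.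
  exact: le_trans (normr_ge0 _) (uM 0%N).
by rewrite (le_trans (ler_norm C)) // lerDl.
Qed.

(* A vector v that almost norms f may be truncated to finite support; if u
   lives beyond that support then v + u and v - u are still in the unit ball,
   so |f u| is small. *)
Lemma c0_dual_tail f (e : R) : c0_dual_pred f -> 0 < e -> exists N : nat,
  forall u (M : R), (forall n, `|val u n| <= M) ->
    (forall n, (n < N)%N -> val u n = 0) -> `|f u| <= e * M.
Proof.
move=> fdual e0; have [C C0 fC] := c0_dual_bound f fdual.
pose B := [set f v | v in [set v : c0 R | forall n, `|val v n| <= 1]].
have ubB : ubound B C.
  move=> _ [v vB <-]; rewrite (le_trans (ler_norm _)) //.
  by rewrite (le_trans (fC v 1 vB)) // mulr1.
have hB : has_sup B.
  split; last by exists C.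
  exists (f (c0_mk _ (cvg_cst 0))), (c0_mk _ (cvg_cst 0)) => //= n.
  by rewrite normr0.
have e20 : 0 < e / 2 by rewrite divr_gt0.
have [_ [v vB <-] fv] := sup_adherent e20 hB.
have d0 : 0 < e / 2 / C by rewrite divr_gt0.
have /cvgrPdist_le/(_ _ d0) := c0_cvg0 v.
case=> N _ vN.
pose w := c0_cut N v.
have fvw : `|f v - f w| <= e / 2.
  have -> : f v - f w = f (c0_comb 1 (-1) v w).
    by rewrite c0_dual_comb // mul1r mulN1r.
  apply: (le_trans (fC _ (e / 2 / C) _)); last by rewrite mulrC divfK // gt_eqF.
  move=> n /=; case: ltnP => nN; first by rewrite mul1r mulN1r subrr normr0 ltW.
  by rewrite mul1r mulr0 addr0; have := vN n nN; rewrite /= sub0r normrN.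
exists N => u M uM u0.
have M0 : 0 <= M := le_trans (normr_ge0 _) (uM 0%N).
have [M00|Mn0] := eqVneq M 0.
  by rewrite (le_trans (fC u M uM)) // M00 !mulr0.
have Mp : 0 < M by rewrite lt_def Mn0.
(* The supports of [w] and [u] are disjoint, so [w + a u] stays in the unit ball; as [f w] is within
   [e] of [sup B], the two signs of [a] bound [f u] from both sides. *)
have H (a : R) : `|a| = M^-1 -> f w + a * f u <= sup B.
  move=> aM; rewrite -[f w]mul1r -c0_dual_comb //.
  apply: (sup_upper_bound hB); exists (c0_comb 1 a w u) => // n.
  rewrite ?(c0_combE, c0_cutE); case: ltnP => nN; first by rewrite u0 // mulr0 addr0 mul1r.
  rewrite mulr0 add0r normrM aM mulrC ler_pdivrMr // mul1r; exact: uM.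
have H1 : M^-1 * f u <= e.
  have := H M^-1; rewrite ger0_norm ?invr_ge0 // => /(_ erefl).
  by move: fv fvw; rewrite ler_norml => ? /andP[? ?] ?; lra.
have H2 : M^-1 * - f u <= e.
  have := H (- M^-1); rewrite normrN ger0_norm ?invr_ge0 // => /(_ erefl).
  rewrite mulrN; move: fv fvw; rewrite ler_norml mulNr => ? /andP[? ?] ?; lra.
rewrite ler_norml; move: H1 H2; rewrite ![M^-1 * _]mulrC !ler_pdivrMr // => H1 H2.
by apply/andP; split; lra.
Qed.

(** Split [l - u] at an index [N]: the head is small by coordinatewise convergence, the tail by
    [c0_dual_tail]. *)
Lemma c0_dual_cvg (G : set_system (c0 R)) (FG : Filter G) l (M : R) f :
  c0_dual_pred f ->
  G [set u | forall n, `|val u n| <= M] -> (forall n, `|val l n| <= M) ->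
  (forall n, (fun u => val u n) @ G --> val l n) ->
  f @ G --> f l.
Proof.
move=> fdual GM lM Gl; have [C C0 fC] := c0_dual_bound f fdual.
have M0 : 0 <= M := le_trans (normr_ge0 _) (lM 0%N).
apply/cvgrPdist_le => e e0.
(* The tail of [l - u] is bounded by [2 M], so this factor makes its contribution at most [e / 2];
   the [+ 1] covers [M = 0]. *)
have M1 : 0 < 4 * (M + 1) by lra.
have [N fN] := c0_dual_tail f (e / (4 * (M + 1))) fdual (divr_gt0 e0 M1).
have d0 : 0 < e / 2 / C by rewrite !divr_gt0.
have Gfin k : G [set u | forall n, (n < k)%N -> `|val l n - val u n| <= e / 2 / C].
  elim: k => [|k IH]; first by apply: filterS filterT => u _ n.
  have /cvgrPdist_le/(_ _ d0) Gk := Gl k.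
  apply: filterS2 IH Gk => u /= h hk n; rewrite ltnS leq_eqVlt => /orP[/eqP->|] //.
  exact: h.
apply: filterS2 GM (Gfin N) => u uM ulN /=.
pose w := c0_comb 1 (-1) l u.
have -> : f l - f u = f w by rewrite c0_dual_comb // mul1r mulN1r.
have -> : f w = f (c0_cut N w) + f (c0_comb 1 (-1) w (c0_cut N w)).
  by rewrite c0_dual_comb // mul1r mulN1r addrC subrK.
have wE n : val w n = val l n - val u n by rewrite /= mul1r mulN1r.
rewrite (le_trans (ler_normD _ _)) // (_ : e = e / 2 + e / 2); last by lra.
apply: lerD.
  apply: (le_trans (fC _ (e / 2 / C) _)); last by rewrite mulrC divfK // gt_eqF.
  move=> n; rewrite c0_cutE; case: ltnP => nN; last by rewrite normr0 ltW.
  by rewrite wE; apply: ulN.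
apply: (le_trans (fN _ (M + M) _ _)).
- move=> n; rewrite c0_combE c0_cutE wE; case: ltnP => nN.
    by rewrite mul1r mulN1r subrr normr0 addr_ge0.
  by rewrite mulr0 addr0 mul1r (le_trans (ler_normB _ _)) // lerD.
- by move=> n nN; rewrite c0_combE c0_cutE nN mul1r mulN1r subrr.
- rewrite mulrAC ler_pdivrMr //; nra.
Qed.

Lemma c0_coord_dual (n : nat) : c0_dual_pred (fun u : c0 R => val u n).
Proof.
split; first by move=> u v w ->.
split; first by move=> a u w ->.
by exists 1 => u M uM; rewrite mul1r.
Qed.

End C0.

(** * The weak topology of [c0] *)

Section C0Weak.
Context {R : realType}.
Implicit Types f : c0 R -> R.

Lemma c0_weak_cvgP (G : set_system (c0_weak R)) (FG : Filter G) (l : c0_weak R) :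
  G --> l <->
  forall f, c0_dual_pred f -> (fun u : c0_weak R => f u) @ G --> f l.
Proof.
set ev := (fun u : c0 R => (fun f : c0_dual R => val f u) : {ptws c0_dual R -> R}).
split=> [Gl f fdual|Gl].
  pose g : c0_dual R := exist _ f (asboolT fdual).
  have evl : ev @ G --> ev l.
    apply: (cvg_trans _ (@initial_continuous _ _ ev l)).
    exact: cvg_app.
  by move=> A /(@proj_continuous (c0_dual R) (fun=> R) g (ev l)) /evl.
have evl : ev @ G --> ev l.
  apply/cvg_sup => -[f fP] A [_ [[V oV <-] Vl] sub]; apply: filterS sub _.
  by apply: (Gl f (asboolW fP)); exact: open_nbhs_nbhs.
move=> A [B [[V Vop <-] Vl] sub]; apply: filterS sub _.
by apply: evl; exact: open_nbhs_nbhs.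
Qed.

Lemma c0_weak_hausdorff : hausdorff_space (c0_weak R).
Proof.
move=> p q; rewrite cluster_cvgE => -[G FG [Gq pG]].
have GF : Filter G by exact: filter_filter.
have Gp : G --> p by move=> A /pG.
apply: val_inj; apply/funext => n.
move/c0_weak_cvgP: Gp => /(_ _ (c0_coord_dual n)) h1.
move/c0_weak_cvgP: Gq => /(_ _ (c0_coord_dual n)) h2.
exact: (cvg_unique _ h1 h2).
Qed.

(** Compactness of the interval gives a cluster point of the image of [G], and a cluster point of an
    ultrafilter is a limit. *)
Lemma ultra_bounded_cvg {T : Type} (G : set_system T) (FG : UltraFilter G)
    (h : T -> R) (a b : R) :
  G [set t | a <= h t <= b] -> exists2 p, a <= p <= b & h @ G --> p.
Proof.
move=> Gab.
have hGab : (h @ G) `[a, b]%classic.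
  rewrite /= /fmap /=; apply: filterS Gab => t tab.
  by rewrite /= in_itv.
have [p [pab pcl]] := segment_compact _ hGab.
exists p; first by move: pab; rewrite /= in_itv/=.
move=> A pA; have [//|GnA] := in_ultra_setVsetC (h @^-1` A) FG.
by have [t []] := pcl (~` A) A GnA pA.
Qed.

End C0Weak.

(** * Balls of the bidual and their images in [c0] *)

Section Dual.
Context {R : realType} {V : normedModType R}.
Implicit Types (f g : V -> R) (phi : (V -> R) -> R) (y : nat -> V -> R).

Lemma is_dualD f g : is_dual f -> is_dual g -> is_dual (fun x => f x + g x).
Proof.
move=> [fD [fZ [C fC]]] [gD [gZ [D gD']]]; split; [|split].
- by move=> x z; rewrite fD gD addrACA.
- by move=> a x; rewrite fZ gZ mulrDr.
- exists (C + D) => x; rewrite mulrDl (le_trans (ler_normD _ _)) //.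
  exact: lerD.
Qed.

Lemma is_dualZ (a : R) f : is_dual f -> is_dual (fun x => a * f x).
Proof.
move=> [fD [fZ [C fC]]]; split; [|split].
- by move=> x z; rewrite fD mulrDr.
- by move=> b x; rewrite fZ mulrCA.
- by exists (`|a| * C) => x; rewrite normrM -mulrA ler_wpM2l.
Qed.

Lemma is_dual_ball_bound f : is_dual f ->
  exists2 M : R, 0 <= M & forall x, `|x| <= 1 -> `|f x| <= M.
Proof.
move=> [_ [_ [C fC]]]; exists `|C| => // x x1.
apply: (le_trans (fC x)); apply: (@le_trans _ _ (`|C| * `|x|)).
  by rewrite ler_wpM2r // ler_norm.
by rewrite ler_piMr.
Qed.

Lemma is_dual_norm_bound f (M : R) : is_dual f ->
  (forall x, `|x| <= 1 -> `|f x| <= M) -> forall x, `|f x| <= M * `|x|.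
Proof.
move=> [_ [fZ _]] fM x; have [->|x0] := eqVneq x 0.
  by rewrite normr0 mulr0 -[X in f X](scale0r 0) fZ mul0r normr0.
have xp : 0 < `|x| by rewrite normr_gt0.
rewrite -ler_pdivrMr // mulrC -[X in X * _]ger0_norm ?invr_ge0 //.
rewrite -normrM -fZ; apply: fM.
by rewrite normrZ ger0_norm ?invr_ge0 // mulVf // gt_eqF.
Qed.

(** The ball of radius [B] in the bidual: [is_bidual] with its constant made explicit. *)
Definition bidual_bounded (B : R) phi : Prop :=
  [/\ forall f g, is_dual f -> is_dual g ->
        phi (fun x => f x + g x) = phi f + phi g,
      forall (a : R) f, is_dual f -> phi (fun x => a * f x) = a * phi f &
      forall f (M : R), is_dual f ->
        (forall x : V, `|x| <= 1 -> `|f x| <= M) -> `|phi f| <= B * M].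

Lemma bidual_bounded_bidual B phi : bidual_bounded B phi -> is_bidual phi.
Proof. by case=> phiD phiZ phiB; split=> //; split=> //; exists B. Qed.

Lemma bidual_bounded_eval (B : R) (x : V) : 0 < B -> `|x| <= B ->
  bidual_bounded B (fun f => f x).
Proof.
move=> B0 xB; split=> // f M fdual fM.
have M0 : 0 <= M by apply: le_trans (fM 0 _); rewrite ?normr_ge0 ?normr0.
apply: (le_trans (is_dual_norm_bound f M fdual fM x)).
by rewrite mulrC ler_wpM2r.
Qed.

(* The limit of functionals along an ultrafilter gives weak* compactness of
   the ball of the bidual; weak nullness of y puts the image sequence in c0. *)
Lemma bidual_ball_image_compact y (C B : R) : weakly_null_dual y ->
  (forall n x, `|y n x| <= C * `|x|) ->
  compact [set l : c0_weak R |
    exists2 phi, bidual_bounded B phi & forall n, val l n = phi (y n)].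
Proof.
move=> [ydual y0] yC; set K := [set l | _].
have yball n x : `|x| <= 1 -> `|y n x| <= `|C|.
  move=> x1; apply: (le_trans (yC n x)); apply: (@le_trans _ _ (`|C| * `|x|)).
    by rewrite ler_wpM2r // ler_norm.
  by rewrite ler_piMr.
rewrite compact_ultra => G GU GK.
have /choice[s sP] : forall l : c0_weak R, exists phi, K l ->
    bidual_bounded B phi /\ forall n, val l n = phi (y n).
  move=> l; have [[phi phiB phiE]|nK] := pselect (K l).
    by exists phi.
  (* The value off [K] is immaterial, since [K] belongs to [G]. *)
  by exists (fun=> 0) => /nK.
pose Phi f := lim ((fun l => s l f) @ G).
have PhiP f : is_dual f -> (fun l => s l f) @ G --> Phi f.
  move=> fdual; have [M _ fM] := is_dual_ball_bound f fdual.
  have [p _ Gp] : exists2 p, - (B * M) <= p <= B * M & (fun l => s l f) @ G --> p.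
    apply: ultra_bounded_cvg; apply: filterS GK => l /sP[[_ _ sB] _] /=.
    by rewrite -ler_norml; exact: sB.
  by apply/cvg_ex; exists p.
(* Identities valid on [K] pass to the limit along [G]; this yields the linearity of [Phi]. *)
have PhiE f (p : R) (h : c0_weak R -> R) : is_dual f -> h @ G --> p ->
    (forall l, K l -> h l = s l f) -> Phi f = p.
  move=> fdual Gp hs; apply: (cvg_unique _ (PhiP f fdual)) => //.
  apply: cvg_trans Gp; apply: near_eq_cvg; apply: filterS GK => l Kl.
  by rewrite hs.
have PhiB : bidual_bounded B Phi.
  split.
  - move=> f g fdual gdual; apply: (PhiE _ _ (fun l => s l f + s l g)).
    + exact: is_dualD.
    + by apply: cvgD; exact: PhiP.
    + by move=> l /sP[[sD _ _] _]; rewrite sD.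
  - move=> a f fdual; apply: (PhiE _ _ (fun l => a * s l f)).
    + exact: is_dualZ.
    + by apply: cvgM; [exact: cvg_cst|exact: PhiP].
    + by move=> l /sP[[_ sZ _] _]; rewrite sZ.
  - move=> f M fdual fM; apply: (cvgr_to_le (cvg_norm (PhiP f fdual))).
    by apply: filterS GK => l /sP[[_ _ sB] _]; exact: sB.
pose l0 : c0 R := c0_mk _ (y0 Phi (bidual_bounded_bidual _ _ PhiB)).
exists l0; split; first by exists Phi.
apply/c0_weak_cvgP => f fdual.
apply: (c0_dual_cvg G _ l0 (B * `|C|)) => //.
- apply: filterS GK => l /sP[[_ _ sB] lE] n /=; rewrite lE.
  by apply: sB => //; exact: yball.
- by have [_ _ H] := PhiB; move=> n; apply: H => //; exact: yball.
- move=> n; apply: cvg_trans (PhiP _ (ydual n)); apply: near_eq_cvg.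
  by apply: filterS GK => l /sP[_ lE]; rewrite lE.
Qed.

(** Evaluation at the points of [A] embeds [A] in a ball of the bidual, whose image is compact,
    hence closed as the weak topology is Hausdorff. *)
Lemma weakly_null_rel_weakly_compact y (C : R) (A : set V) :
  weakly_null_dual y -> (forall n x, `|y n x| <= C * `|x|) ->
  bounded_set_nm A ->
  rel_weakly_compact_c0 ((fun x n => y n x) @` A).
Proof.
move=> ynull yC [M AM].
have M0 : 0 < `|M| + 1 by rewrite ltr_pwDr.
have AM' x : A x -> bidual_bounded (`|M| + 1) (fun f : V -> R => f x).
  move=> Ax; apply: bidual_bounded_eval => //.
  by rewrite (le_trans (AM x Ax)) // (le_trans (ler_norm M)) // lerDl.
split.
  move=> _ [x Ax <-]; have [_ y0] := ynull.
  exact: (y0 _ (bidual_bounded_bidual _ _ (AM' x Ax))).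
have Kco := bidual_ball_image_compact y C (`|M| + 1) ynull yC.
rewrite -precompactE; apply: precompact_subset; last first.
  rewrite precompact_closed; first exact: Kco.
  exact: (compact_closed c0_weak_hausdorff Kco).
move=> l [x Ax xl]; exists (fun f => f x); first exact: AM'.
by move=> n; rewrite -xl.
Qed.

End Dual.

(** * Helly's theorem and the passage from weak compactness to weak nullness *)

Section Helly.
Context {R : realType} {V : normedModType R}.
Implicit Types (phi : (V -> R) -> R) (y : nat -> V -> R).

Lemma bidual_bounded_sum (B : R) phi y (a : nat -> R) (N : nat) :
  bidual_bounded B phi -> (forall n, is_dual (y n)) ->
  is_dual (fun x => \sum_(i < N) a i * y i x) /\
  phi (fun x => \sum_(i < N) a i * y i x) = \sum_(i < N) a i * phi (y i).
Proof.
move=> [phiD phiZ _] ydual; elim: N => [|N [IHd IHp]].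
  have E : (fun x => \sum_(i < 0) a i * y i x) = (fun x => 0 * y 0%N x).
    by apply/funext => x; rewrite big_ord0 mul0r.
  by rewrite E big_ord0; split; [exact: is_dualZ|rewrite phiZ // mul0r].
have E : (fun x => \sum_(i < N.+1) a i * y i x) =
         (fun x => \sum_(i < N) a i * y i x + a N * y N x).
  by apply/funext => x; rewrite big_ord_recr.
rewrite E big_ord_recr; split; first by apply: is_dualD => //; exact: is_dualZ.
by rewrite phiD ?phiZ ?IHp //; exact: is_dualZ.
Qed.

(* Helly's theorem. Otherwise the convex set of the vectors (y_i x) stays at a
   positive distance from (phi y_i); at an almost nearest point x the first
   variation shows that the functional with coefficients phi y_i - y_i x
   separates the two, against the bound on phi. *)
Lemma helly phi y (N : nat) (e : R) : bidual_bounded 1 phi ->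
  (forall n, is_dual (y n)) -> 0 < e ->
  exists2 x : V, `|x| <= 1 &
    forall i, (i < N)%N -> `|phi (y i) - y i x| <= e.
Proof.
move=> phiB ydual e0.
pose q x := \sum_(i < N) (phi (y i) - y i x) ^+ 2.
have q0 x : 0 <= q x by apply: sumr_ge0 => i _; exact: sqr_ge0.
pose Q := [set q x | x in [set x : V | `|x| <= 1]].
have hQ : has_inf Q.
  split; first by exists (q 0), 0 => //=; rewrite normr0.
  by exists 0 => _ [x _ <-].
have infQ x : `|x| <= 1 -> inf Q <= q x.
  by move=> x1; apply: ge_inf; [case: hQ|exists x].
have [small|large] := ltP (inf Q) (e ^+ 2).
  have gap : 0 < e ^+ 2 - inf Q by rewrite subr_gt0.
  have [_ [x x1 <-]] := inf_adherent gap hQ.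
  rewrite addrC subrK => qx; exists x => // i iN.
  suff : `|phi (y i) - y i x| ^+ 2 <= e ^+ 2.
    by rewrite ler_sqr ?nnegrE // ltW.
  rewrite real_normK ?num_real //.
  apply: le_trans (ltW qx); rewrite /q (bigD1 (Ordinal iN)) //= lerDl.
  by apply: sumr_ge0 => j _; exact: sqr_ge0.
exfalso.
have /choice[D DP] : forall n, exists M : R, 0 <= M /\
    forall x, `|x| <= 1 -> `|y n x| <= M.
  move=> n; have [M M0 yM] := is_dual_ball_bound (y n) (ydual n).
  by exists M.
have yD n x z : y n (x + z) = y n x + y n z by case: (ydual n).
have yZ n a x : y n (a *: x) = a * y n x by case: (ydual n) => _ [].
(* The sum bounds the second-order term of [q] along segments in the ball; adding [e ^+ 2] makes
   [Kb] positive and the step length [t] below at most 1. *)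
pose Kb := \sum_(i < N) (D i + D i) ^+ 2 + e ^+ 2.
have e20 : 0 < e ^+ 2 by rewrite exprn_gt0.
have Kbe : e ^+ 2 <= Kb.
  by rewrite lerDr; apply: sumr_ge0 => i _; exact: sqr_ge0.
have Kb0 : 0 < Kb := lt_le_trans e20 Kbe.
have W x z : `|x| <= 1 -> `|z| <= 1 ->
    \sum_(i < N) (y i z - y i x) ^+ 2 <= Kb.
  move=> x1 z1; apply: (@le_trans _ _ (\sum_(i < N) (D i + D i) ^+ 2)).
    apply: ler_sum => i _; have [Di0 yDi] := DP i.
    rewrite -[leLHS]real_normK ?num_real // ler_sqr ?nnegrE ?addr_ge0 //.
    by rewrite (le_trans (ler_normB _ _)) // lerD // yDi.
  by rewrite lerDl ltW.
pose t := e ^+ 2 / (2 * Kb).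
have t0 : 0 < t by rewrite divr_gt0 // mulr_gt0.
have t1 : t <= 1 by rewrite ler_pdivrMr ?mulr_gt0 //; lra.
have tKb : t * Kb = e ^+ 2 / 2.
  by rewrite /t; field; rewrite gt_eqF.
(* Moving from [x] towards [z] by [t], the near-minimality defect and the second-order term each
   cost at most [t * e ^+ 2 / 2]; dividing by [2 * t] leaves the slack [e ^+ 2 / 2] in [S]. *)
have eta0 : 0 < t * e ^+ 2 / 2 by rewrite divr_gt0 // mulr_gt0.
have [_ [x x1 <-] qx] := inf_adherent eta0 hQ.
pose a i := phi (y i) - y i x.
pose g z := \sum_(i < N) a i * y i z.
have S z : `|z| <= 1 -> g z <= g x + e ^+ 2 / 2.
  move=> z1.
  have xz1 : `|(1 - t) *: x + t *: z| <= 1.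
    have t1' : 0 <= 1 - t by rewrite subr_ge0.
    have tz := ler_piMr (ltW t0) z1; have tx := ler_piMr t1' x1.
    rewrite (le_trans (ler_normD _ _)) // 2!normrZ (ger0_norm t1').
    rewrite (ger0_norm (ltW t0)); lra.
  have qE : q ((1 - t) *: x + t *: z) =
      q x - 2 * t * (g z - g x) + t ^+ 2 * \sum_(i < N) (y i z - y i x) ^+ 2.
    rewrite /q /g -sumrB !mulr_sumr -sumrB -big_split; apply: eq_bigr => i _ /=.
    by rewrite yD !yZ /a; ring.
  have := infQ _ xz1; rewrite qE => h.
  have := W x z x1 z1; rewrite -(ler_pM2l (exprn_gt0 2 t0)) => h2.
  have h3 : t ^+ 2 * Kb = t * (e ^+ 2 / 2) by rewrite expr2 -mulrA tKb.
  rewrite -lerBlDl -(ler_pM2l t0); lra.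
have [gdual phig] := bidual_bounded_sum 1 phi y a N phiB ydual.
have gN z : g (- z) = - g z.
  rewrite /g -sumrN; apply: eq_bigr => i _.
  by rewrite -scaleN1r yZ mulN1r mulrN.
have gM z : `|z| <= 1 -> `|g z| <= g x + e ^+ 2 / 2.
  move=> z1; rewrite ler_norml S // andbT lerNl -gN; apply: S.
  by rewrite normrN.
case: phiB => _ _ /(_ _ _ gdual gM); rewrite phig mul1r.
move/(le_trans (ler_norm _)) => H.
have qE : q x = \sum_(i < N) a i * phi (y i) - g x.
  rewrite /q /g -sumrB; apply: eq_bigr => i _; rewrite /a; ring.
(* Now [q x <= e ^+ 2 / 2], although [q x >= inf Q >= e ^+ 2]. *)
by have := infQ x x1; rewrite qE => ?; lra.
Qed.

Lemma rel_weakly_compact_weakly_null y : (forall n, is_dual (y n)) ->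
  rel_weakly_compact_c0 ((fun x n => y n x) @` @unit_ball R V) ->
  weakly_null_dual y.
Proof.
move=> ydual [yc0 yco]; split=> // phi [phiD [phiZ [C phiC]]].
have C0 : 0 < `|C| + 1 by rewrite ltr_pwDr.
(* Rescaling into the unit ball of the bidual, where [helly] applies. *)
pose psi f := (`|C| + 1)^-1 * phi f.
have psiB : bidual_bounded 1 psi.
  split.
  - by move=> f g fd gd; rewrite /psi phiD // mulrDr.
  - by move=> a f fd; rewrite /psi phiZ // mulrCA.
  - move=> f M fd fM; rewrite /psi normrM ger0_norm ?invr_ge0 ?(ltW C0) //.
    have M0 : 0 <= M by apply: le_trans (fM 0 _); rewrite ?normr_ge0 ?normr0.
    rewrite mulrC ler_pdivrMr // mul1r mulrC (le_trans (phiC f M fd fM)) //.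
    by rewrite ler_wpM2r // (le_trans (ler_norm C)) // lerDl.
have /choice[x xP] : forall k, exists z : V, `|z| <= 1 /\
    forall i, (i < k)%N -> `|psi (y i) - y i z| <= k.+1%:R^-1.
  move=> k.
  have k0 : 0 < k.+1%:R^-1 :> R by rewrite invr_gt0 ltr0n.
  have [z z1 zP] := helly psi y k _ psiB ydual k0.
  by exists z.
have xball k : ((fun x n => y n x) @` @unit_ball R V) (fun n => y n (x k)).
  by exists (x k) => //; case: (xP k).
pose u k : c0_weak R := c0_mk _ (yc0 _ (xball k)).
have ucl : (u @ \oo) (closure [set v : c0_weak R |
    ((fun x n => y n x) @` @unit_ball R V) (val v)]).
  by exists 0%N => // k _; apply: subset_closure; exact: xball.
have [l [_]] := yco _ _ ucl.
rewrite cluster_cvgE => -[G GP [Gl uG]].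
(* [G] refines the sequence [u] and converges weakly to [l], so each coordinate has two limits along
   [G], which must agree. *)
have lE n : val l n = psi (y n).
  have GF : Filter G by exact: filter_filter.
  move/c0_weak_cvgP: Gl => /(_ _ (c0_coord_dual n)) h1.
  apply: (cvg_unique _ h1) => //.
  have h2 : (fun k => y n (x k)) @ \oo --> psi (y n).
    apply/cvgrPdist_le => e e0.
    have [M _ MP] := near_infty_natSinv_lt (PosNum e0).
    exists (maxn M n.+1) => // k /=; rewrite geq_max => /andP[Mk nk].
    have [_ /(_ n nk)] := xP k; move/le_trans; apply.
    by apply: ltW; exact: MP.
  move=> A /h2 hA; exact: (uG ((fun v : c0 R => val v n) @^-1` A) hA).
have -> : (fun n => phi (y n)) = (fun n => (`|C| + 1) * val l n).
  by apply/funext => n; rewrite lE /psi mulrA mulfV ?gt_eqF // mul1r.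
rewrite -[X in _ --> X](mulr0 (`|C| + 1)); apply: cvgM; first exact: cvg_cst.
exact: c0_cvg0.
Qed.

End Helly.

(** * Uniform boundedness of weak* null sequences *)

Lemma weak_star_null_bounded (R : realType) (F : completeNormedModType R)
    (y : nat -> F -> R) : weak_star_null y ->
  exists C : R, forall n v, `|y n v| <= C * `|v|.
Proof.
move=> [ydual y0].
have lin (f : F -> R^o) : range y f -> bounded_fun_norm f /\ linear f.
  move=> [n _ <-]; have [yD [yZ [C yC]]] := ydual n; split.
    move=> r; exists (`|C| * r) => v vr.
    apply: (le_trans (yC v)); apply: (@le_trans _ _ (`|C| * `|v|)).
      by rewrite ler_wpM2r // ler_norm.
    exact: ler_wpM2l.
  by move=> a v w; rewrite yD yZ.
have bnd : pointwise_bounded (range y : set (F -> R^o)).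
  move=> v; have /cvg_seq_bounded [M [_ MP]] : cvgn (fun n => y n v).
    by apply/cvg_ex; exists 0; exact: y0.
  exists (M + 1) => _ [n _ <-]; apply: (MP (M + 1)) => //.
  by rewrite ltrDl.
have [M MP] := Banach_Steinhauss lin bnd 1.
exists M => n v; apply: is_dual_norm_bound; first exact: ydual.
by move=> w w1; apply: MP => //; exists n.
Qed.

(** * Almost Grothendieck operators and sets *)

Section Operator.
Context {R : realType} {X F : completeNormedModType R} (le : F -> F -> Prop).
Variables (T : {linear X -> F}) (hT : continuous T).

Lemma continuous_linear_norm_bound :
  exists2 C : R, 0 < C & forall x, `|T x| <= C * `|x|.
Proof.
have /linear_boundedP /pinfty_ex_gt0 := continuous_linear_bounded 0 (hT 0).
by case=> C C0 TC; exists C.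
Qed.

Lemma is_dual_comp (f : F -> R) : is_dual f -> is_dual (fun x => f (T x)).
Proof.
move=> [fD [fZ [C fC]]]; have [K K0 TK] := continuous_linear_norm_bound.
split; [|split].
- by move=> x z; rewrite linearD fD.
- by move=> a x; rewrite linearZ fZ.
- exists (`|C| * K) => x; apply: (le_trans (fC _)).
  apply: (@le_trans _ _ (`|C| * `|T x|)); first by rewrite ler_wpM2r // ler_norm.
  by rewrite -mulrA ler_wpM2l.
Qed.

Lemma almost_Grothendieck_op_bounded_set (A : set X) :
  almost_Grothendieck_op le T -> bounded_set_nm A ->
  almost_Grothendieck_set le (T @` A).
Proof.
move=> TG Abnd S [[S0 [Sdual [C SC]]] Sdisj].
have [K K0 TK] := continuous_linear_norm_bound.
rewrite image_comp.
apply: (@weakly_null_rel_weakly_compact _ _ (fun n x => S (T x) n) (`|C| * K)) => //.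
  by apply: (TG (fun n v => S v n)) => //; split.
move=> n x; apply: (le_trans (SC _ n)).
apply: (@le_trans _ _ (`|C| * `|T x|)); first by rewrite ler_wpM2r // ler_norm.
by rewrite -mulrA ler_wpM2l.
Qed.

Lemma almost_Grothendieck_ball_op :
  almost_Grothendieck_set le (T @` @unit_ball R X) ->
  almost_Grothendieck_op le T.
Proof.
move=> TB y ynull ydisj.
have [C yC] := weak_star_null_bounded _ _ _ ynull.
have [ydual y0] := ynull.
have := TB (fun v n => y n v); rewrite image_comp => TB'.
apply: rel_weakly_compact_weakly_null.
  by move=> n; exact: is_dual_comp.
apply: TB'; split=> //; split=> //; split=> //.
by exists C => v n; exact: yC.
Qed.

End Operator.

Theorem mainTheorem3 (R : realType) (X F : completeNormedModType R)
    (le : F -> F -> Prop) (join : F -> F -> F)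
    (hF : isBanachLattice le join)
    (T : {linear X -> F}) (hT : continuous T) :
  [<-> almost_Grothendieck_op le T;
       forall S : F -> nat -> R, disjoint_c0_operator le S ->
         weakly_compact_c0_operator (fun x => S (T x));
       forall A : set X, bounded_set_nm A ->
         almost_Grothendieck_set le (T @` A);
       almost_Grothendieck_set le (T @` @unit_ball R X)].
Proof.
have ball_bounded : bounded_set_nm (@unit_ball R X) by exists 1.
tfae.
- move=> TG S hS; rewrite /weakly_compact_c0_operator -(image_comp T S).
  exact: (almost_Grothendieck_op_bounded_set le T hT _ TG ball_bounded S hS).
(* From (2) to (3) by way of (1): statement (2) is (4) up to composing images, and (4) gives (1). *)
- move=> TS A; apply: almost_Grothendieck_op_bounded_set => //.
  apply: almost_Grothendieck_ball_op => // S hS.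
  by rewrite image_comp; exact: TS.
- by apply.
- exact: almost_Grothendieck_ball_op.
Qed.
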